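(* Let $\mathbf{A}$ be a finite algebra and consider the conditions: (i) $\mathbf{A}$ has a Maltsev polynomial; (ii) $\mathbf{A}$ has a pointed cube polynomial; (iii) $\mathbf{A}$ is a spread of its type $\mathbf{2}$ minimal sets; (iv) $d_{\mathbf{A}}(n)\in O(n)$; (v) $d_{\mathbf{A}}(n)\notin 2^{\Omega(n)}$; (vi) no finite power $\mathbf{A}^n$ has a nontrivial strongly abelian homomorphic image. Then for every finite algebra the implications (i)$\Rightarrow$(iv), (i)$\Rightarrow$(ii)$\Rightarrow$(v), and (iii)$\Rightarrow$(iv)$\Rightarrow$(v)$\Rightarrow$(vi) hold. Moreover, each of the following non-implications is witnessed by a finite algebra (i.e. there is a finite algebra satisfying the first condition but not the second): (vi)$\not\Rightarrow$(v), (v)$\not\Rightarrow$(iv), (iv)$\not\Rightarrow$(iii), (iii)$\not\Rightarrow$(ii), (ii)$\not\Rightarrow$(iv), (iv)$\not\Rightarrow$(ii), and (i)$\not\Rightarrow$(iii).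
   Context: For an algebra $\mathbf{A}$, $d_{\mathbf{A}}(n)$ denotes the least size of a generating set of $\mathbf{A}^n$. Big Oh notation: $f\in O(g)$ if $|f(x)|\le M|g(x)|$ for some constants $M,N>0$ and all $x>N$; $f\in\Omega(g)$ if $|f(x)|\ge M|g(x)|$ for all $x>N$; $2^{\Omega(n)}$ is the class of functions of the form $2^{h(n)}$ with $h\in\Omega(n)$. A Maltsev polynomial is a polynomial $F(x,y,z)$ with $F(x,y,y)=x=F(y,y,x)$ identically. A term $F(x_1,\dots,x_m)$ is an $m$-ary, $p$-pointed, $k$-cube term for $\mathbf{A}$ if there is a $k\times m$ matrix $M$ whose entries are variables and $p$ distinct constant symbols (interpreted as elements of $A$), with every column of $M$ containing a symbol different from the variable $x$, such that $\mathbf{A}$ satisfies $F(M)\approx (x,\dots,x)^T$, meaning that $F$ applied to each row of $M$ equals $x$. A pointed cube polynomial of $\mathbf{A}$ is a pointed cube term of the expansion of $\mathbf{A}$ by all constants. A subset $S\subseteq A$ is a spread of a collection $\mathcal U$ of subsets of $A$ if $S=p(U_1,\dots,U_k)$ for some polynomial $p$ of $\mathbf{A}$ and some (not necessarily distinct) $U_1,\dots,U_k\in\mathcal U$. Minimal sets, their types, and strongly abelian algebras are in the sense of tame congruence theory (Hobby–McKenzie); ''type $\mathbf{2}$ minimal sets'' are the $\langle\alpha,\beta\rangle$-minimal sets for prime quotients $\alpha\prec\beta$ of the congruence lattice of type $\mathbf{2}$. *)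

(* Defs.v *)
From HB Require Import structures.
From mathcomp Require Import all_boot all_algebra.
From Stdlib Require Import Reals ClassicalEpsilon.

Set Implicit Arguments.
Unset Strict Implicit.
Unset Printing Implicit Defensive.

Import GRing.Theory.

Record signature := Sig { sym : Type; arity : sym -> nat }.

Record algebra (S : signature) := Algebra {
  acar :> finType;
  aop : forall f : sym S, ('I_(arity f) -> acar) -> acar }.

(* Terms over S in n variables, with constant symbols from C.
   C = void : terms;  C = the universe of A : polynomials of A. *)
Inductive pterm (S : signature) (C : Type) (n : nat) : Type :=
| PVar of 'I_n
| PConst of C
| PApp (f : sym S) of ('I_(arity f) -> pterm S C n).

Arguments PVar {S C n}.
Arguments PConst {S C n}.
Arguments PApp {S C n}.

Fixpoint peval (S : signature) (A : algebra S) (C : Type) (k : C -> A) (n : nat)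
    (t : pterm S C n) (x : 'I_n -> A) : A :=
  match t with
  | PVar i => x i
  | PConst c => k c
  | PApp f ts => @aop S A f (fun j => @peval S A C k n (ts j) x)
  end.

Definition teval (S : signature) (A : algebra S) n (t : pterm S void n) x : A :=
  @peval S A void (fun v : void => match v with end) n t x.
Definition poleval (S : signature) (A : algebra S) n (t : pterm S A n) x : A :=
  @peval S A A (fun a : A => a) n t x.

Definition power_alg (S : signature) (A : algebra S) (n : nat) : algebra S :=
  @Algebra S {ffun 'I_n -> A}
    (fun f args => [ffun j => @aop S A f (fun l => args l j)]).

Definition is_hom (S : signature) (A B : algebra S) (h : A -> B) :=
  forall (f : sym S) (args : 'I_(arity f) -> A),
    h (@aop S A f args) = @aop S B f (fun l => h (args l)).

Definition generated_by_k (S : signature) (A : algebra S) (n k : nat) : Prop :=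
  exists g : 'I_k -> power_alg A n,
    forall y : power_alg A n, exists t : pterm S void k, y = teval t g.

Definition gen_pred (S : signature) (A : algebra S) (n : nat) : pred nat :=
  fun k => if excluded_middle_informative (generated_by_k A n k) then true else false.

Lemma gen_pred_ex (S : signature) (A : algebra S) (n : nat) :
  exists k, gen_pred A n k.
Proof.
exists #|power_alg A n|; rewrite /gen_pred.
case: excluded_middle_informative => // H; exfalso; apply: H.
exists (fun i => enum_val i) => y; exists (PVar (enum_rank y)).
by rewrite /teval /= enum_rankK.
Qed.

Definition dA (S : signature) (A : algebra S) (n : nat) : nat :=
  ex_minn (gen_pred_ex A n).

Open Scope R_scope.

Definition bigO_n (f : nat -> nat) : Prop :=
  exists M N : R, 0 < M /\ 0 < N /\
    forall n : nat, N < INR n -> Rabs (INR (f n)) <= M * Rabs (INR n).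

(* f in 2^{Omega(n)} (eventual reading): f(n) >= 2^{h(n)}
   with h(n) >= M n for n > N. *)
Definition exp_Omega_n (f : nat -> nat) : Prop :=
  exists M N : R, 0 < M /\ 0 < N /\
    forall n : nat, N < INR n -> Rpower 2 (M * INR n) <= INR (f n).

Close Scope R_scope.

Definition tup3 (T : Type) (a b c : T) : 'I_3 -> T :=
  fun i => match val i with 0 => a | 1 => b | _ => c end.

Definition has_maltsev_poly (S : signature) (A : algebra S) : Prop :=
  exists F : pterm S A 3, forall x y : A,
    poleval F (tup3 x y y) = x /\ poleval F (tup3 y y x) = x.

(* entries of the matrix M: variables (numbered; x is variable 0)
   or constant symbols interpreted as elements of A *)
Inductive centry (T : Type) := CVar of nat | CConst of T.
Arguments CVar {T}.
Arguments CConst {T}.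

Definition cval (T : Type) (s : nat -> T) (e : centry T) : T :=
  match e with CVar v => s v | CConst a => a end.

(* F is an m-ary, p-pointed (p = number of distinct constants occurring
   in M), k-cube polynomial of A *)
Definition has_pointed_cube_poly (S : signature) (A : algebra S) : Prop :=
  exists (m k : nat) (F : pterm S A m) (M : 'I_k -> 'I_m -> centry A),
    (0 < k)%N /\
    (forall j : 'I_m, exists i : 'I_k, M i j <> CVar 0) /\
    (forall (s : nat -> A) (i : 'I_k), poleval F (fun j => cval s (M i j)) = s 0%N).

Definition is_congr (S : signature) (A : algebra S) (th : rel A) : Prop :=
  equivalence_rel th /\
  forall (f : sym S) (a b : 'I_(arity f) -> A),
    (forall i, th (a i) (b i)) -> th (@aop S A f a) (@aop S A f b).

Definition prime_quot (S : signature) (A : algebra S) (al be : rel A) : Prop :=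
  [/\ is_congr al, is_congr be, subrel al be,
      (exists a b, be a b /\ ~~ al a b) &
      forall g : rel A, is_congr g -> subrel al g -> subrel g be ->
        (forall a b, g a b = al a b) \/ (forall a b, g a b = be a b)].

Definition in_UA (S : signature) (A : algebra S) (al be : rel A) (U : {set A}) : Prop :=
  exists f : pterm S A 1,
    U = [set poleval f (fun _ => x) | x in A] /\
    exists a b : A, be a b /\ ~~ al (poleval f (fun _ => a)) (poleval f (fun _ => b)).

Definition minimal_set (S : signature) (A : algebra S) (al be : rel A) (U : {set A}) : Prop :=
  in_UA al be U /\ forall V, in_UA al be V -> V \subset U -> V = U.

Definition is_trace (S : signature) (A : algebra S) (al be : rel A) (U N : {set A}) : Prop :=
  (exists b : A, N = U :&: [set x | be b x]) /\
  exists x y, [/\ x \in N, y \in N & ~~ al x y].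

Local Open Scope ring_scope.

(* The minimal algebra A|_N / alpha|_N (universe N/alpha, operations all
   polynomials of A under which N is closed) is polynomially equivalent to a
   one-dimensional vector space over a finite field F: phi identifies N/alpha
   with F, and the polynomial operations of A|_N/alpha|_N are exactly the
   affine maps (x_i) |-> c + sum_i k_i x_i over F. *)
Definition minalg_type2 (S : signature) (A : algebra S) (al : rel A) (N : {set A}) : Prop :=
  exists (F : finFieldType) (phi : A -> F),
    [/\ (forall y : F, exists2 x, x \in N & phi x = y),
        (forall x y, x \in N -> y \in N -> (phi x == phi y) = al x y),
        (forall n (t : pterm S A n),
           (forall x : 'I_n -> A, (forall i, x i \in N) -> poleval t x \in N) ->
           exists (c : F) (k : 'I_n -> F), forall x : 'I_n -> A, (forall i, x i \in N) ->
             phi (poleval t x) = c + \sum_i k i * phi (x i)) &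
        (forall n (c : F) (k : 'I_n -> F), exists t : pterm S A n,
           (forall x : 'I_n -> A, (forall i, x i \in N) -> poleval t x \in N) /\
           forall x : 'I_n -> A, (forall i, x i \in N) ->
             phi (poleval t x) = c + \sum_i k i * phi (x i))].

Local Close Scope ring_scope.

Definition type2_quot (S : signature) (A : algebra S) (al be : rel A) : Prop :=
  prime_quot al be /\
  exists U N : {set A}, [/\ minimal_set al be U, is_trace al be U N & minalg_type2 al N].

Definition type2_minset (S : signature) (A : algebra S) (U : {set A}) : Prop :=
  exists al be : rel A, type2_quot al be /\ minimal_set al be U.

Definition spread_of_type2 (S : signature) (A : algebra S) : Prop :=
  exists (k : nat) (p : pterm S A k) (Us : 'I_k -> {set A}),
    (forall i, type2_minset (Us i)) /\
    forall y : A, exists x : 'I_k -> A, (forall i, x i \in Us i) /\ poleval p x = y.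

Definition ext1 (T : Type) (n : nat) (a : T) (c : 'I_n -> T) : 'I_n.+1 -> T :=
  fun i => if unlift ord0 i is Some j then c j else a.

Definition strongly_abelian (S : signature) (B : algebra S) : Prop :=
  forall (n : nat) (t : pterm S void n.+1) (a b e : B) (c d : 'I_n -> B),
    teval t (ext1 a c) = teval t (ext1 b d) -> teval t (ext1 e c) = teval t (ext1 e d).

Definition cond_i (S : signature) (A : algebra S) := has_maltsev_poly A.
Definition cond_ii (S : signature) (A : algebra S) := has_pointed_cube_poly A.
Definition cond_iii (S : signature) (A : algebra S) := spread_of_type2 A.
Definition cond_iv (S : signature) (A : algebra S) := bigO_n (dA A).
Definition cond_v (S : signature) (A : algebra S) := ~ exp_Omega_n (dA A).
Definition cond_vi (S : signature) (A : algebra S) :=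
  ~ exists (n : nat) (B : algebra S) (h : power_alg A n -> B),
      [/\ is_hom h, (forall y : B, exists x, h x = y), (1 < #|B|)%N & strongly_abelian B].

Definition witnessed (P Q : forall S : signature, algebra S -> Prop) : Prop :=
  exists (S : signature) (A : algebra S), (0 < #|A|)%N /\ P S A /\ ~ Q S A.

(* Main.v *)
(** (ii)=>(v): iterating a [k]-row pointed cube polynomial [t] times on the
    index set [[k]^t] writes every tuple in terms of [m^t |A|^((k-1)^t)] tuples
    and the constants, which is subexponential in [k^t].

    (i),(iii)=>(iv): it is enough to have a polynomial [q] with
    [q(0,u) = u = q(u,0)] on a set [U], for then the tuples with one nonzero
    entry generate [U^n].  A Maltsev polynomial gives one on [A].  On a minimal
    set of type 2 one starts from vector addition on a trace and corrects it by
    iterates of the permutations [u |-> q(0,u)] and [u |-> q(u,0)]; every other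
    minimal set of the same prime quotient is a polynomial image of this one.

    (v)=>(vi): in a finite strongly abelian [B] a term depends on at most
    [log2 |B|] variables, so [k] elements generate only polynomially many.

    Non-implications: the flat semilattice with two atoms for (vi), not (v);
    an operation making the indicators of pairs irreducible for (ii), not (iv),
    hence also (v), not (iv); an [F_2]-linear algebra on the plane whose
    operations read only first coordinates for (iii), not (ii), hence also
    (iv), not (ii); the two-element Boolean ring for (i), not (iii), hence also
    (iv), not (iii). *)

From Stdlib Require Import Reals Lra Lia ClassicalEpsilon FunctionalExtensionality.
Require Import Defs.
From mathcomp Require Import all_boot all_algebra.
From mathcomp Require Import zify.

Set Implicit Arguments.
Unset Strict Implicit.
Unset Printing Implicit Defensive.

Import GRing.Theory.

(** * Growth rates *)

Lemma leq_expl e m n : m <= n -> m ^ e <= n ^ e.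
Proof. by case: e => // e; rewrite leq_exp2r. Qed.

Local Open Scope R_scope.

Lemma INR_expn (a n : nat) : INR (a ^ n)%N = (INR a ^ n).
Proof. by elim: n => [|n IHn]; rewrite ?expn0 // expnS mult_INR IHn. Qed.

Lemma Rpower_INR_pow (b x : R) (n : nat) :
  Rpower b (x * INR n) = (Rpower b x ^ n).
Proof. by rewrite -Rpower_mult Rpower_pow //; apply: exp_pos. Qed.

(** An integer [D] above [1/M] turns the real exponent into an inequality between natural numbers;
    conversely [1/D] serves as the rate. The growth estimates for (ii) and (vi) can thus be made in
    [nat]. *)
Lemma exp_Omega_natP (f : nat -> nat) :
  exp_Omega_n f <->
  exists D N : nat, (0 < D)%N /\ forall n : nat, (N <= n -> 2 ^ n <= f n ^ D)%N.
Proof.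
split.
- case=> M [N [hM [hN h]]].
  have [D hD] := INR_unbounded (/ M); have [N0 hN0] := INR_unbounded N.
  have D0 : 0 < INR D by have := Rinv_0_lt_compat _ hM; lra.
  exists D, N0; split; first by apply/ltP/INR_lt.
  move=> n hn; apply/leP/INR_le; rewrite !INR_expn.
  have hNn : N < INR n by have /leP/le_INR := hn; lra.
  apply: (Rle_trans _ _ _ _ (pow_incr _ _ D (conj (Rlt_le _ _ (exp_pos _)) (h n hNn)))).
  rewrite -[Rpower _ _ ^ _]Rpower_INR_pow.
  have -> : M * INR n * INR D = (M * INR D) * INR n by ring.
  rewrite Rpower_INR_pow; apply: pow_incr; split; first exact: pos_INR.
  rewrite -[X in X <= _](Rpower_1 (INR 2)) /=; last by lra.
  apply: Rle_Rpower; first by lra.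
  by apply: Rlt_le; rewrite -(Rinv_r M); [apply: Rmult_lt_compat_l | lra].
- case=> D [N [D0 h]].
  have D0' : 0 < INR D by apply/lt_0_INR/ltP.
  exists (/ INR D), (INR N + 1); split; first exact: Rinv_0_lt_compat.
  split; first by have := pos_INR N; lra.
  move=> n hn.
  have /h /leP /le_INR : (N <= n)%N by apply/leP/INR_le; lra.
  rewrite !INR_expn => h1.
  case: (Rle_lt_dec (Rpower 2 (/ INR D * INR n)) (INR (f n))) => // hlt; exfalso.
  have : INR (f n) ^ D < Rpower 2 (/ INR D * INR n) ^ D.
    have fn0 := pos_INR (f n).
    elim: D D0 {D0' h h1 hn} (Rpower _ _) hlt => // D IHD _ r hr.
    case: D IHD => [|D] IHD; first by rewrite /=; lra.
    have {}IHD := IHD isT r hr.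
    change (INR (f n) * INR (f n) ^ D.+1 < r * r ^ D.+1).
    apply: (Rle_lt_trans _ (r * INR (f n) ^ D.+1)); last by apply: Rmult_lt_compat_l => //; lra.
    by apply: Rmult_le_compat_r; [apply: pow_le | lra].
  rewrite -Rpower_INR_pow.
  have -> : / INR D * INR n * INR D = 1 * INR n by field; lra.
  rewrite Rpower_INR_pow Rpower_1; last by lra.
  by have e2 : INR 2 = 2 by []; rewrite e2 in h1; lra.
Qed.

Lemma bigO_of_leq (f : nat -> nat) (C : nat) :
  (forall n, f n.+1 <= C * n.+1)%N -> bigO_n f.
Proof.
(* The threshold [1/2] leaves out only [n = 0]; the [+ 1] keeps the factor positive when [C = 0]. *)
move=> h; exists (INR C + 1), (/ 2); split; first by have := pos_INR C; lra.
split; first lra.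
case=> [|n] hn; first by move: hn => /=; lra.
rewrite !Rabs_pos_eq; try exact: pos_INR.
have /leP/le_INR := h n; rewrite mult_INR => h1.
by have := pos_INR n.+1; nra.
Qed.

(** With [d = c ln 2 / 2], [2^(cn)] is the square of [exp(dn) > 1 + dn], so it exceeds [d^2 n^2],
    which is above [M n] once [n > M / d^2]. *)
Lemma bigO_not_exp (f : nat -> nat) : bigO_n f -> ~ exp_Omega_n f.
Proof.
move=> [M [N [hM [hN hf]]]] [c [N' [hc [hN' he]]]].
have l2 : 0 < c * ln 2 / 2 by have := ln_lt_2; nra.
set d := (c * ln 2 / 2) in l2.
have [n hn] := INR_unbounded (N + N' + M / (d * d)).
have dd : 0 < d * d by nra.
have hMd : 0 < M / (d * d) by apply: Rdiv_lt_0_compat.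
have n0 : 0 < INR n by lra.
have h1 := hf n ltac:(lra); have h2 := he n ltac:(lra).
rewrite !Rabs_pos_eq in h1; try exact: pos_INR.
have h3 : Rpower 2 (c * INR n) = exp (d * INR n) * exp (d * INR n).
  by rewrite -exp_plus /Rpower; congr (exp _); rewrite /d; field.
have h4 : 1 + d * INR n < exp (d * INR n) by apply: exp_ineq1; nra.
have h5 : M < d * d * INR n.
  have -> : M = d * d * (M / (d * d)) by field; nra.
  by apply: Rmult_lt_compat_l => //; lra.
have : 0 < d * INR n by nra.
nra.
Qed.

Lemma bigO_not_quadratic (f : nat -> nat) :
  (forall n, n * n.-1 <= 2 * f n)%N -> ~ bigO_n f.
Proof.
move=> h [M [N [hM [hN hf]]]].
have [n hn] := INR_unbounded (N + 2 * M + 1).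
case: n hn => [|n] hn; first by move: hn => /=; lra.
have h1 := hf n.+1 ltac:(lra).
rewrite !Rabs_pos_eq in h1; try exact: pos_INR.
have /leP/le_INR := h n.+1; rewrite !mult_INR.
by move: h1 hn; rewrite [_.+1.-1]/= S_INR -/(INR 2) => h1 hn; rewrite (_ : INR 2 = 2) //; nra.
Qed.

Local Close Scope R_scope.

(** * Generation of powers by polynomials *)

Section Terms.
Variable S : signature.

Fixpoint pbind (C C' : Type) (n m : nat) (vt : 'I_n -> pterm S C' m)
    (ct : C -> pterm S C' m) (t : pterm S C n) : pterm S C' m :=
  match t with
  | PVar i => vt i
  | PConst c => ct c
  | PApp f ts => PApp f (fun j => pbind vt ct (ts j))
  end.

Lemma peval_bind (A : algebra S) (C C' : Type) (k : C -> A) (k' : C' -> A) n m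
    (vt : 'I_n -> pterm S C' m) ct (t : pterm S C n) x y :
  (forall i, peval k' (vt i) x = y i) -> (forall c, peval k' (ct c) x = k c) ->
  peval k' (pbind vt ct t) x = peval k t y.
Proof.
move=> hv hc; elim: t => [i|c|f ts IH] //=.
by congr (aop _); apply: functional_extensionality => j; apply: IH.
Qed.

Lemma peval_congr (A : algebra S) (th : rel A) (C : Type) (k : C -> A) n
    (t : pterm S C n) x y :
  is_congr th -> (forall i, th (x i) (y i)) -> th (peval k t x) (peval k t y).
Proof.
case=> [he ho] hxy; elim: t => [i|c|f ts IH] //=; first by have [] := he (k c) (k c) (k c).
exact: ho.
Qed.

Lemma teval_hom (A B : algebra S) (h : A -> B) n (t : pterm S void n) x :
  is_hom h -> h (teval t x) = teval t (fun i => h (x i)).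
Proof.
move=> hh; elim: t => [i|[]|f ts IH] //=.
rewrite /teval /= hh; congr (aop _); apply: functional_extensionality => j; exact: IH.
Qed.

Lemma teval_power (A : algebra S) n k (t : pterm S void k) (g : 'I_k -> power_alg A n) i :
  teval t g i = teval t (fun l => g l i).
Proof.
rewrite /teval; elim: t => [l|[]|f ts IH] //=; rewrite ffunE.
by congr (aop _); apply: functional_extensionality => j; apply: IH.
Qed.

Definition psubst (A : algebra S) n m (t : pterm S A n) (ts : 'I_n -> pterm S A m) :
  pterm S A m := pbind ts PConst t.

Lemma poleval_subst (A : algebra S) n m (t : pterm S A n) (ts : 'I_n -> pterm S A m) x :
  poleval (psubst t ts) x = poleval t (fun i => poleval (ts i) x).
Proof. exact: peval_bind. Qed.

Definition tsubst n m (t : pterm S void n) (ts : 'I_n -> pterm S void m) :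
  pterm S void m := pbind ts PConst t.

Lemma teval_subst (A : algebra S) n m (t : pterm S void n) (ts : 'I_n -> pterm S void m)
    (x : 'I_m -> A) :
  teval (tsubst t ts) x = teval t (fun i => teval (ts i) x).
Proof. by apply: peval_bind => // -[]. Qed.

Lemma dA_gen (A : algebra S) n : generated_by_k A n (dA A n).
Proof.
rewrite /dA; case: ex_minnP => k; rewrite /gen_pred.
by case: excluded_middle_informative.
Qed.

Lemma dA_min (A : algebra S) n k : generated_by_k A n k -> dA A n <= k.
Proof.
move=> h; rewrite /dA; case: ex_minnP => k0 _; apply; rewrite /gen_pred.
by case: excluded_middle_informative.
Qed.

(** Polynomials replace terms because the constants will cost only [#|A|] further generators.
    Coordinates and generators range over arbitrary finite types, so that powers indexed by words
    can be treated directly. *)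
Definition pol_generated (A : algebra S) (I J : finType) (G : J -> I -> A) (y : I -> A) : Prop :=
  exists t : pterm S A #|J|, forall i, y i = poleval t (fun l => G (enum_val l) i).

Lemma pol_generated_gen (A : algebra S) (I J : finType) (G : J -> I -> A) j : pol_generated G (G j).
Proof. by exists (PVar (enum_rank j)) => i; rewrite /poleval /= enum_rankK. Qed.

Lemma pol_generated_ext (A : algebra S) (I J : finType) (G : J -> I -> A) y y' :
  (forall i, y i = y' i) -> pol_generated G y -> pol_generated G y'.
Proof. by move=> h [t ht]; exists t => i; rewrite -h. Qed.

Lemma pol_generated_const (A : algebra S) (I J : finType) (G : J -> I -> A) a :
  pol_generated G (fun _ => a).
Proof. by exists (PConst a). Qed.

Lemma pol_generated_app (A : algebra S) (I J : finType) (G : J -> I -> A) m (t : pterm S A m)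
    (ys : 'I_m -> I -> A) :
  (forall l, pol_generated G (ys l)) -> pol_generated G (fun i => poleval t (fun l => ys l i)).
Proof.
move=> /fin_all_exists [ts hts]; exists (psubst t ts) => i.
by rewrite poleval_subst; congr poleval; apply: functional_extensionality => l; rewrite hts.
Qed.

(* The constant tuples are added to the generators, turning constants of
   polynomials into variables of terms. *)
Lemma dA_pol_generated (A : algebra S) (I J : finType) (G : J -> I -> A) :
  (forall y, pol_generated G y) -> dA A #|I| <= #|J| + #|A|.
Proof.
move=> hG; rewrite -card_sum; apply: dA_min.
pose val (u : J + A) (i : I) : A := match u with inl j => G j i | inr a => a end.
exists (fun l => [ffun i => val (enum_val l) (enum_val i)]) => y.
have [t ht] := hG (fun i => y (enum_rank i)).
exists (pbind (fun l => PVar (enum_rank (inl A (enum_val l))))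
              (fun c => PVar (enum_rank (inr J c))) t).
apply/ffunP => i; rewrite teval_power.
have := ht (enum_val i); rewrite enum_valK => ->.
by symmetry; apply: peval_bind => u /=; rewrite ffunE enum_rankK.
Qed.

(** The background value is left free, since different sets [U] may have different zeros; the number
    of these tuples remains linear in [n]. *)
Definition unit_tuple (A : algebra S) n (j : A * 'I_n * A) (i : 'I_n) : A :=
  if i == j.1.2 then j.2 else j.1.1.

Definition zero_add (A : algebra S) (U : {set A}) : Prop :=
  exists (z : A) (q : A -> A -> A) (t : pterm S A 2),
    [/\ z \in U, (forall x, poleval t x = q (x ord0) (x ord_max)),
        (forall u, u \in U -> q z u = u) & forall u, u \in U -> q u z = u].

(** Induction on a prefix of [y] continued by [z]: the next entry is added as a unit tuple over [z],
    and at every coordinate one of the two arguments of [q] is [z]. *)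
Lemma pol_generated_zero_add (A : algebra S) (U : {set A}) n (y : 'I_n -> A) :
  zero_add U -> (forall i, y i \in U) -> pol_generated (@unit_tuple A n) y.
Proof.
case=> z [q [t [zU tq qz zq]]] yU.
suff H m : m <= n -> pol_generated (@unit_tuple A n) (fun i : 'I_n => if i < m then y i else z).
  by apply: pol_generated_ext (H n (leqnn n)) => i; rewrite ltn_ord.
elim: m => [|m IHm] hm; first by apply: pol_generated_ext (pol_generated_const _ z).
pose im := Ordinal hm.
pose ys (l : 'I_2) := if l == ord0 then (fun i : 'I_n => if i < m then y i else z)
  else @unit_tuple A n (z, im, y im).
have : pol_generated (@unit_tuple A n) (fun i => poleval t (fun l => ys l i)).
  apply: pol_generated_app => l; rewrite /ys; case: ifP => _;
    [exact: IHm (ltnW hm) | exact: pol_generated_gen].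
apply: pol_generated_ext => i; rewrite tq /ys /= /unit_tuple /= ltnS.
have -> : (i == im) = (i == m :> nat) by [].
case: (ltngtP i m) => [_|_|e]; rewrite ?zq ?qz //.
by congr y; apply: val_inj.
Qed.

Lemma dA_unit_tuples (A : algebra S) :
  (forall n y, pol_generated (@unit_tuple A n) y) -> cond_iv A.
Proof.
move=> h; apply: (@bigO_of_leq _ (#|A| * #|A| + #|A|)) => n.
have := dA_pol_generated (h n.+1); rewrite !card_prod !card_ord; nia.
Qed.

End Terms.

(** * Minimal sets of type 2 *)

Section TypeTwo.
Variables (S : signature) (A : algebra S).

Definition unary_pol (f : A -> A) := exists t : pterm S A 1, forall x, poleval t (fun _ => x) = f x.

Definition binary_pol (q : A -> A -> A) :=
  exists t : pterm S A 2, forall x, poleval t x = q (x ord0) (x ord_max).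

Lemma unary_pol_id : unary_pol id.
Proof. by exists (PVar ord0). Qed.

Lemma unary_pol_comp f g : unary_pol f -> unary_pol g -> unary_pol (f \o g).
Proof.
move=> [t ht] [u hu]; exists (psubst t (fun _ => u)) => x.
by rewrite poleval_subst /= -hu -ht.
Qed.

Lemma unary_pol_iter f n : unary_pol f -> unary_pol (iter n f).
Proof. by move=> hf; elim: n => [|n IHn]; [apply: unary_pol_id | apply: (unary_pol_comp hf)]. Qed.

Lemma unary_pol_app (f : sym S) (k : 'I_(arity f)) (c : 'I_(arity f) -> A) :
  unary_pol (fun x => aop (fun i => if i == k then x else c i)).
Proof.
exists (PApp f (fun i => if i == k then PVar ord0 else PConst (c i))) => x.
by rewrite /poleval /=; congr (aop _); apply: functional_extensionality => i; case: ifP.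
Qed.

Lemma binary_pol_comp f q : unary_pol f -> binary_pol q -> binary_pol (fun x y => f (q x y)).
Proof.
move=> [t ht] [u hu]; exists (psubst t (fun _ => u)) => x.
by rewrite poleval_subst /= -hu -ht.
Qed.

Lemma binary_pol_compl f q : unary_pol f -> binary_pol q -> binary_pol (fun x y => q (f x) y).
Proof.
move=> [t ht] [u hu].
exists (psubst u (fun l => if l == ord0 then psubst t (fun _ => PVar ord0) else PVar l)) => x.
by rewrite poleval_subst hu /= poleval_subst -ht.
Qed.

Lemma binary_pol_l q a : binary_pol q -> unary_pol (q a).
Proof.
move=> [u hu].
exists (psubst u (fun l => if l == ord0 then PConst a else PVar ord0)) => x.
by rewrite poleval_subst hu.
Qed.

Lemma binary_pol_r q a : binary_pol q -> unary_pol (q^~ a).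
Proof.
move=> [u hu].
exists (psubst u (fun l => if l == ord0 then PVar ord0 else PConst a)) => x.
by rewrite poleval_subst hu.
Qed.

Lemma unary_pol_congr th f x y : is_congr th -> unary_pol f -> th x y -> th (f x) (f y).
Proof. by move=> hth [t ht] hxy; rewrite -!ht; apply: peval_congr. Qed.

Lemma in_UAE al be U : in_UA al be U <->
  exists f, [/\ unary_pol f, U = f @: [set: A] & exists a b, be a b /\ ~~ al (f a) (f b)].
Proof.
split.
- move=> [t [-> hab]]; exists (fun x => poleval t (fun _ => x)); split=> //; first by exists t.
  by apply/setP => y; apply/imsetP/imsetP => -[x _ ->]; exists x.
- move=> [f [[t ht] -> [a [b [h1 h2]]]]]; exists t; split; last by exists a, b; rewrite !ht.
  by apply/setP => y; apply/imsetP/imsetP => -[x _ ->]; exists x; rewrite ?ht.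
Qed.

Lemma congr_refl th : @is_congr S A th -> reflexive th.
Proof. by case=> he _ x; case: (he x x x). Qed.

Lemma congr_trans th : @is_congr S A th -> transitive th.
Proof. by case=> he _ y x z xy; have [_ ->] := he x y z. Qed.

Lemma congr_sym th : @is_congr S A th -> symmetric th.
Proof.
move=> hc x y; have hr := congr_refl hc; case: hc => he _.
by apply/idP/idP => xy; [have [_ /(_ xy)] := he x y x | have [_ /(_ xy)] := he y x y]; rewrite hr.
Qed.

Definition pbool (P : Prop) : bool := if excluded_middle_informative P then true else false.

Lemma pboolP (P : Prop) : reflect P (pbool P).
Proof. by rewrite /pbool; case: excluded_middle_informative => h; constructor. Qed.

(* The pairs of [be] that every [g \o h] collapses into [al] form a
   congruence between [al] and [be], which primality forces to be [al]. *)
Lemma prime_separation al be g a b :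
  @prime_quot S A al be -> unary_pol g ->
  (exists x y, be x y /\ ~~ al (g x) (g y)) -> be a b -> ~~ al a b ->
  exists h, unary_pol h /\ ~~ al (g (h a)) (g (h b)).
Proof.
move=> [hal hbe sub _ hprime] hg [x [y [bxy nxy]]] bab nab.
pose de x y := be x y && pbool (forall h, unary_pol h -> al (g (h x)) (g (h y))).
have deP u v : reflect (be u v /\ forall h, unary_pol h -> al (g (h u)) (g (h v))) (de u v).
  by apply: (iffP andP) => -[h1 /pboolP h2].
have de_refl u : de u u.
  by apply/deP; split=> [|h hh]; apply: congr_refl.
have de_sym u v : de u v -> de v u.
  move=> /deP [h1 h2]; apply/deP; split=> [|h hh]; first by rewrite congr_sym.
  by rewrite congr_sym // h2.
have de_trans u v w : de u v -> de v w -> de u w.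
  move=> /deP [h1 h2] /deP [h3 h4]; apply/deP; split=> [|h hh]; first exact: congr_trans h1 h3.
  by apply: congr_trans (h2 h hh) (h4 h hh).
have hde : is_congr de.
  split.
    move=> u v w; split=> // uv; apply/idP/idP => [uw|]; last exact: de_trans.
    by apply: de_trans uw; apply: de_sym.
  move=> f c d hcd.
  (* Compatibility is checked one argument at a time: [hyb m] takes its first [m] arguments from [d]
     and the others from [c]. *)
  pose hyb m (i : 'I_(arity f)) := if i < m then d i else c i.
  suff H m : m <= arity f -> de (aop c) (aop (hyb m)).
    suff <- : hyb (arity f) = d by exact: H.
    by apply: functional_extensionality => i; rewrite /hyb ltn_ord.
  elim: m => [|m IHm] hm; first exact: de_refl.
  apply: de_trans (IHm (ltnW hm)) _.
  pose k := Ordinal hm; pose F z := aop (fun i => if i == k then z else hyb m i).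
  have -> : aop (hyb m) = F (c k).
    congr (aop _); apply: functional_extensionality => i; rewrite /hyb.
    by case: eqP => [->|//]; rewrite ltnn.
  have -> : aop (hyb m.+1) = F (d k).
    congr (aop _); apply: functional_extensionality => i; rewrite /hyb ltnS.
    have -> : (i == k) = (i == m :> nat) by [].
    case: (ltngtP i m) => // e.
    by congr d; apply: val_inj.
  have hF : unary_pol F by exact: unary_pol_app.
  have /deP [h1 h2] := hcd k.
  apply/deP; split; first exact: unary_pol_congr.
  by move=> h hh; apply: (h2 (h \o F)); apply: unary_pol_comp.
have alde : subrel al de.
  move=> u v uv; apply/deP; split; first exact: sub.
  by move=> h hh; apply: (unary_pol_congr hal hg (unary_pol_congr hal hh uv)).
case: (hprime de hde alde) => [u v /deP []//|H|H].
- have /deP hn : ~~ de a b by rewrite H.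
  apply/pboolP/negPn/negP => /pboolP hno; apply: hn; split=> // h hh.
  by apply/negPn/negP => hx; apply: hno; exists h.
- have /deP [_ /(_ _ unary_pol_id)] : de x y by rewrite H.
  by move: nxy => /negP.
Qed.

(** Let [f] and [g] have ranges [U] and [V]. Separating a pair kept apart by [f] yields [h] such
    that [g \o h \o f] still does not collapse [be] into [al]; its range lies in [V], hence equals
    [V] by minimality. *)
Lemma minimal_set_image al be U V :
  @prime_quot S A al be -> minimal_set al be U -> minimal_set al be V ->
  exists f, [/\ unary_pol f, forall x, f x \in V & f @: U = V].
Proof.
move=> hp [/in_UAE [f [hf eU [a [b [hab nab]]]]] _] [/in_UAE [g [hg eV hxy]] minV].
have hbe : is_congr be by case: hp.
have [h [hh nh]] := prime_separation hp hg hxy (unary_pol_congr hbe hf hab) nab.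
exists (g \o h); split; first exact: unary_pol_comp.
  by move=> x; rewrite eV; apply: imset_f.
apply: minV; last by apply/subsetP => _ /imsetP [x _ ->]; rewrite eV; apply: imset_f.
apply/in_UAE; exists (g \o h \o f); split.
- by do 2! apply: unary_pol_comp => //.
- by rewrite eU -imset_comp.
- by exists a, b.
Qed.

(** On [U] the map is a permutation, and its cycle lengths, being at most [#|T|], divide the
    factorial. *)
Lemma iter_fact_id (T : finType) (U : {set T}) (f : T -> T) :
  f @: U = U -> {in U, forall x, iter (#|T|`!) f x = x}.
Proof.
move=> fU x xU.
have fin : {in U, forall y, f y \in U} by move=> y yU; rewrite -fU imset_f.
have inj : {in U &, injective f} by apply/imset_injP; rewrite fU.
have /dvdnP [m ->] : fingraph.order f x %| #|T|`!.
  by rewrite dvdn_fact // order_gt0 max_card.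
elim: m => // m IHm; rewrite mulSn iterD IHm.
exact: (iter_order_in fin inj).
Qed.

(** A polynomial map of [A] into [U] that permutes [U] has an iterate that is an idempotent
    retraction onto [U]. *)
Lemma minimal_set_retract al be U : @prime_quot S A al be -> minimal_set al be U ->
  exists e, [/\ unary_pol e, forall x, e x \in U & {in U, forall x, e x = x}].
Proof.
move=> hp hU; have [f [hf fU fim]] := minimal_set_image hp hU hU.
exists (iter #|A|`! f); split; [exact: unary_pol_iter | | exact: iter_fact_id].
by move=> x; have := fact_gt0 #|A|; case: (#|A|`!) => //= m _; apply: fU.
Qed.

Lemma minimal_set_perm al be U f x y : prime_quot al be -> minimal_set al be U ->
  unary_pol f -> (forall z, f z \in U) -> be x y -> x \in U -> y \in U -> ~~ al (f x) (f y) ->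
  f @: U = U.
Proof.
move=> hp hU hf fU bxy xU yU nxy; have [e [he eU eid]] := minimal_set_retract hp hU.
apply: hU.2; last by apply/subsetP => _ /imsetP [z _ ->]; apply: fU.
apply/in_UAE; exists (f \o e); split; first exact: unary_pol_comp.
  apply/setP => u; apply/imsetP/imsetP => -[z zU ->]; first by exists z; rewrite //= eid.
  by exists (e z).
by exists x, y; rewrite /= !eid.
Qed.

(** Vector addition is available only on the trace and modulo [al], so [z] is at first an identity
    only up to [al] on [N]. This already makes both translations by [z] permutations of [U], and
    composing with their inverses makes [z] an exact identity. *)
Lemma type2_zero_add al be U N :
  prime_quot al be -> minimal_set al be U -> is_trace al be U N -> minalg_type2 al N ->
  @zero_add S A U.
Proof.
move=> hp hU [[b eN] [x [y [xN yN nxy]]]] [F [phi [phiN phi_al _ hpol]]].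
have hbe : is_congr be by case: hp.
have NU u : u \in N -> u \in U by rewrite eN => /setIP [].
have bxy : be x y.
  move: xN yN; rewrite eN !inE => /andP [_ bx] /andP [_ by_].
  by apply: congr_trans by_; rewrite // congr_sym.
have [z zN phiz] := phiN 0%R.
have [t [tN ht]] := hpol 2 0%R (fun _ => 1%R).
have [e [he eU eid]] := minimal_set_retract hp hU.
pose tup (u v : A) (l : 'I_2) := if l == ord0 then u else v.
have tupN u v : u \in N -> v \in N -> forall l, tup u v l \in N.
  by move=> hu hv l; rewrite /tup; case: ifP.
pose q u v := e (poleval t (tup u v)).
have hq : binary_pol q.
  apply: binary_pol_comp => //; exists t => w; congr (poleval t _).
  apply: functional_extensionality => -[[|[|]] // i]; rewrite /tup /=.
    by congr w; apply: val_inj.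
  by congr w; apply: val_inj.
have qU u v : q u v \in U by exact: eU.
have qN u v : u \in N -> v \in N -> q u v \in N.
  by move=> hu hv; rewrite /q eid ?NU //; apply/tN/tupN.
have phiq u v : u \in N -> v \in N -> phi (q u v) = (phi u + phi v)%R.
  move=> hu hv; rewrite /q eid; last by apply/NU/tN/tupN.
  rewrite ht; last exact: tupN.
  by rewrite big_ord_recl big_ord1 /= !mul1r add0r.
have perm_of f : unary_pol f -> (forall u, f u \in U) ->
    (forall u, u \in N -> f u \in N /\ phi (f u) = phi u) -> f @: U = U.
  move=> hf fU hfN; have [fxN fx] := hfN x xN; have [fyN fy] := hfN y yN.
  apply: (minimal_set_perm hp hU hf fU bxy (NU _ xN) (NU _ yN)).
  by rewrite -phi_al // fx fy phi_al.
(* With [#|A|! = k + 1], the [k]-th iterate is the inverse on [U] of a permutation of [U]. *)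
have [k ek] : exists k, #|A|`! = k.+1 by exists (#|A|`!).-1; rewrite prednK ?fact_gt0.
have iterP f : unary_pol f -> (forall u, f u \in U) ->
    (forall u, u \in N -> f u \in N /\ phi (f u) = phi u) ->
    [/\ forall u, u \in U -> iter k f (f u) = u, forall u, u \in U -> f (iter k f u) = u,
       forall u, u \in U -> iter k f u \in U &
       forall u, u \in N -> iter k f u \in N /\ phi (iter k f u) = phi u].
  move=> hf fU hfN; have := iter_fact_id (perm_of f hf fU hfN); rewrite ek => hid.
  split=> [u uU|u uU|u uU|u uN]; first by rewrite -iterSr hid.
  - by rewrite -iterS hid.
  - by case: (k) => // m; rewrite iterS.
  - elim: (k) => //= m [mN pm]; have [] := hfN _ mN; by rewrite pm.
have r0N u : u \in N -> q z u \in N /\ phi (q z u) = phi u.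
  by move=> uN; rewrite qN // phiq // phiz add0r.
have [k1 k2 k3 k4] := iterP (q z) (binary_pol_l z hq) (qU z) r0N.
(* First correction: undoing [q z] makes [z] a left identity and leaves [phi] of the sum unchanged
   on [N]. *)
pose q1 u v := iter k (q z) (q u v).
have hq1 : binary_pol q1 by apply: (binary_pol_comp (unary_pol_iter k (binary_pol_l z hq))).
have q1U u v : q1 u v \in U by apply: k3.
have q1z u : u \in U -> q1 z u = u by exact: k1.
have r1N u : u \in N -> q1 u z \in N /\ phi (q1 u z) = phi u.
  move=> uN; have [h1 h2] := k4 _ (qN _ _ uN zN).
  by rewrite /q1 h2 phiq // phiz addr0.
have [l1 l2 l3 l4] := iterP (q1^~ z) (binary_pol_r z hq1) (fun u => q1U u z) r1N.
have [t2 ht2] := binary_pol_compl (unary_pol_iter k (binary_pol_r z hq1)) hq1.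
exists z, (fun u v => q1 (iter k (q1^~ z) u) v), t2; split;
  [exact: NU | exact: ht2 | | by move=> u uU; apply: l2].
(* The second correction, applied to the left argument, fixes [z], so [z] remains a left
   identity. *)
move=> u uU; suff -> : iter k (q1^~ z) z = z by exact: q1z.
by elim: (k) => //= m ->; rewrite q1z // NU.
Qed.

(** The minimal set [U] carrying the trace may differ from [Us l]: the tuples are generated over [U]
    and then carried to [Us l] by a unary polynomial. *)
Lemma spread_dA : cond_iii A -> cond_iv A.
Proof.
move=> [k [p [Us [hUs hp]]]]; apply: dA_unit_tuples => n y.
have /fin_all_exists [xs hxs] i := hp (y i).
have : pol_generated (@unit_tuple S A n) (fun i => poleval p (fun l => xs i l)).
  apply: (pol_generated_app p (ys := fun l i => xs i l)) => l.
  have [al [be [[hpq [U [N [hU hN hM]]]] hUl]]] := hUs l.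
  have hz := type2_zero_add hpq hU hN hM.
  have [f [[t ht] fU fim]] := minimal_set_image hpq hU hUl.
  have /fin_all_exists [u hu] i : exists u, u \in U /\ f u = xs i l.
    have := (hxs i).1 l; rewrite -fim => /imsetP [u uU ->]; by exists u.
  have : pol_generated (@unit_tuple S A n) (fun i => poleval t (fun _ => u i)).
    by apply: (pol_generated_app t (ys := fun _ => u)) => _;
      apply: pol_generated_zero_add hz _ => i; case: (hu i).
  by apply: pol_generated_ext => i; rewrite ht; case: (hu i).
by apply: pol_generated_ext => i; case: (hxs i).
Qed.

(** For any fixed [z], the polynomial [F(x, z, y)] has [z] as a two-sided identity on all of [A]. *)
Lemma maltsev_dA : 0 < #|A| -> cond_i A -> cond_iv A.
Proof.
move=> /card_gt0P [z _] [F hF]; apply: dA_unit_tuples => n y.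
apply: (@pol_generated_zero_add _ _ setT); last by move=> i; rewrite inE.
exists z, (fun x y => poleval F (tup3 x z y)).
exists (psubst F (tup3 (PVar ord0) (PConst z) (PVar ord_max))); split=> //.
- move=> x; rewrite poleval_subst; congr poleval.
  by apply: functional_extensionality => -[[|[|]]].
- by move=> u _; have [] := hF u z.
- by move=> u _; have [] := hF u z.
Qed.
End TypeTwo.

(** * Pointed cube polynomials *)

(** This is the term [C(t,2) k^(t-2)] of the expansion of [(k+1)^t], obtained by induction from the
    linear estimate [h1]. *)
Lemma quadratic_expn_leq k t : k ^ t * (t * t.-1) <= 2 * k ^ 2 * k.+1 ^ t.
Proof.
have h1 s : k ^ s * s <= k * k.+1 ^ s.
  elim: s => [|s IHs]; first by rewrite muln0.
  have : k ^ s <= k.+1 ^ s by exact: leq_expl.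
  by rewrite !expnS; nia.
elim: t => [|t IHt]; first by rewrite muln0.
have := h1 t; case: t IHt => [|t] IHt h; first by rewrite muln0.
rewrite /= in IHt *; rewrite (expnS k t.+1) (expnS k.+1 t.+1).
set a := k ^ t.+1 in IHt h *; set b := k.+1 ^ t.+1 in IHt h *.
nia.
Qed.

Section Cube.
Variables (S : signature) (A : algebra S).

Lemma maltsev_cube : cond_i A -> cond_ii A.
Proof.
move=> [F hF]; exists 3, 2, F.
exists (fun i => if i == ord0 then tup3 (CVar 0) (CVar 1) (CVar 1)
                 else tup3 (CVar 1) (CVar 1) (CVar 0)); split=> //; split.
  case=> [[|[|[|j]]] hj] //; [by exists ord_max | by exists ord0 | by exists ord0].
move=> s i; have [h1 h2] := hF (s 0) (s 1).
case: ifP => _; [rewrite -[RHS]h1 | rewrite -[RHS]h2]; congr poleval;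
  by apply: functional_extensionality => -[[|[|[|j]]] hj].
Qed.

(** * Iteration of a pointed cube polynomial *)

Section Iterate.
Variables (m k : nat) (F : pterm S A m) (M : 'I_k.+2 -> 'I_m -> centry A) (a0 : A).
Variable (row : 'I_m -> 'I_k.+2).
Hypothesis row_nx : forall j, M (row j) j <> CVar 0.
Hypothesis FM : forall s i, poleval F (fun j => cval s (M i j)) = s 0%N.

(** Variables other than [x] are frozen at [a0], so each entry becomes a unary map, which is
    constant in the row chosen for its column. *)
Definition subst_entry i j (x : A) : A := cval (fun v => if v == 0 then x else a0) (M i j).

Lemma subst_entry_row j x y : subst_entry (row j) j x = subst_entry (row j) j y.
Proof.
rewrite /subst_entry; have := @row_nx j; case: (M _ _) => //= v.
by case: eqP => // ->.
Qed.

Fixpoint subst_word (w : seq ('I_k.+2 * 'I_m)) (x : A) : A :=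
  if w is (i, j) :: w' then subst_entry i j (subst_word w' x) else x.

Lemma subst_word_row w x y : has (fun u => u.1 == row u.2) w -> subst_word w x = subst_word w y.
Proof.
elim: w => [|[i j] w IHw] //= /orP [/eqP ->|/IHw ->] //.
exact: subst_entry_row.
Qed.

Lemma subst_word_F w i x : poleval F (fun j => subst_word ((i, j) :: w) x) = subst_word w x.
Proof. exact: (@FM (fun v => if v == 0 then subst_word w x else a0) i). Qed.

(* On the coordinates [i : [t] -> [k+2]] avoiding the rows chosen by the word
   [j] the generator copies an arbitrary function of the [(k+1)^t] remaining
   coordinates; on the others its value does not depend on that function. *)
Definition cube_gen t (u : {ffun 'I_t -> 'I_m} * {ffun {ffun 'I_t -> 'I_k.+1} -> A})
    (i : {ffun 'I_t -> 'I_k.+2}) : A :=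
  subst_word [seq (i s, u.1 s) | s <- enum 'I_t]
    (u.2 [ffun s => odflt ord0 (unlift (row (u.1 s)) (i s))]).

(** This tuple is itself a generator: at a coordinate meeting a chosen row both sides are
    independent of [y], and elsewhere [unlift] recovers the coordinate. *)
Lemma cube_gen_subst_word t (j : {ffun 'I_t -> 'I_m}) (y : {ffun 'I_t -> 'I_k.+2} -> A) :
  pol_generated (@cube_gen t) (fun i => subst_word [seq (i s, j s) | s <- enum 'I_t] (y i)).
Proof.
pose c : {ffun {ffun 'I_t -> 'I_k.+1} -> A} :=
  [ffun r : {ffun 'I_t -> 'I_k.+1} => y [ffun s => lift (row (j s)) (r s)]].
apply: pol_generated_ext (pol_generated_gen _ (j, c)) => i; rewrite /cube_gen /=.
case: (boolP (has (fun u => u.1 == row u.2) [seq (i s, j s) | s <- enum 'I_t])).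
  exact: subst_word_row.
rewrite has_map => /hasPn hn; congr subst_word; rewrite ffunE; congr y.
apply/ffunP => s; rewrite !ffunE.
have /= : i s != row (j s) by apply: (hn s); rewrite mem_enum.
by rewrite eq_sym => /unlift_some [l hl ->] /=.
Qed.

(** Full words give generators. Applying [F] to the [m] words that differ only in the column at one
    position removes that letter, by the cube identity; removing all letters leaves [y]. *)
Lemma cube_pol_generated t (y : {ffun 'I_t -> 'I_k.+2} -> A) : pol_generated (@cube_gen t) y.
Proof.
suff H r w : enum 'I_t = r ++ w -> forall j : 'I_t -> 'I_m,
    pol_generated (@cube_gen t) (fun i => subst_word [seq (i s, j s) | s <- w] (y i)).
  (* For [m = 0] no column function [j] need exist, but then [F] is a constant equal to every value
     of [y]. *)
  case: (posnP m) => [m0|m_gt0].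
    apply: pol_generated_ext (pol_generated_const _ (poleval F (fun j : 'I_m => a0))) => i.
    rewrite -(FM (fun _ => y i) ord0); congr poleval; apply: functional_extensionality => j.
    by have := ltn_ord j; rewrite {2}m0.
  by apply: (H (enum 'I_t) [::]) => [|_]; rewrite ?cats0 //; apply: Ordinal m_gt0.
elim/last_ind: r w => [|r s IHr] w.
  move=> /= <- j; apply: pol_generated_ext (cube_gen_subst_word (finfun j) y) => i.
  by congr subst_word; apply: eq_map => s; rewrite ffunE.
rewrite cat_rcons => e j.
have snw : s \notin w.
  by have := enum_uniq 'I_t; rewrite e cat_uniq => /and3P [_ _ /andP []].
have /(pol_generated_app F) : forall l : 'I_m, pol_generated (@cube_gen t)
    (fun i => subst_word ((i s, l) :: [seq (i s', j s') | s' <- w]) (y i)).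
  move=> l; apply: pol_generated_ext (IHr _ e (fun s' => if s' == s then l else j s')) => i.
  rewrite /= eqxx; congr (subst_entry _ _ (subst_word _ _)); apply/eq_in_map => s' hs'.
  by case: eqP => // es; rewrite -es hs' in snw.
by apply: pol_generated_ext => i; rewrite subst_word_F.
Qed.

Lemma dA_cube_leq t : dA A (k.+2 ^ t) <= m ^ t * #|A| ^ (k.+1 ^ t) + #|A|.
Proof. by have := dA_pol_generated (@cube_pol_generated t);
  rewrite card_prod !card_ffun !card_ord. Qed.
End Iterate.

(** In dimension [(K+1)^t] there are at most [2^(E t K^t)] generators, so exponential growth would
    give [(K+1)^t <= D E t K^t], against the quadratic estimate. *)
Lemma cube_not_exp : 0 < #|A| -> cond_ii A -> cond_v A.
Proof.
move=> /card_gt0P [a0 _] [m [k [F [M [k_gt0 [hcol FM]]]]]] /exp_Omega_natP [D [N [D_gt0 hexp]]].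
(* Repeating a row gives at least two of them. *)
case: k k_gt0 M hcol FM => // k _ M hcol FM.
pose M' (i : 'I_k.+2) := M (odflt ord0 (unlift ord0 i)).
have FM' s i : poleval F (fun j => cval s (M' i j)) = s 0%N by exact: FM.
have /fin_all_exists [row hrow] j : exists i, M' i j <> CVar 0.
  by have [i hi] := hcol j; exists (lift ord0 i); rewrite /M' liftK.
set a := #|A|; set K := k.+1.
(* [E] absorbs the bases [m] and [a]; [t] is taken so that [t - 1] exceeds [2 K^2 D E] and the
   dimension is at least [N]. *)
pose E := m + a + a + 1.
pose t := (2 * K ^ 2 * (D * E) + N).+3.
have h1 := dA_cube_leq a0 hrow FM' t; rewrite -/a -/K in h1.
have lt_exp n : n <= 2 ^ n by exact/ltnW/ltn_expl.
have tK : t <= K.+1 ^ t.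
  by apply: leq_trans (lt_exp t) _; rewrite leq_exp2r.
have /hexp h2 : N <= K.+1 ^ t by apply: leq_trans tK; rewrite /t; lia.
have K1 : 0 < K ^ t by rewrite expn_gt0.
have h3 : m ^ t * a ^ (K ^ t) + a <= 2 ^ (E * t * K ^ t).
  have h31 : m ^ t * a ^ (K ^ t) <= 2 ^ (m * t + a * K ^ t).
    by rewrite expnD !(expnM 2); apply: leq_mul; apply: leq_expl; apply: lt_exp.
  apply: (@leq_trans (2 ^ (m * t + a * K ^ t + a).+1)); last first.
    by rewrite leq_exp2l // /E; set X := K ^ t in K1 *; have : 0 < t by []; nia.
  have := lt_exp a; rewrite expnS (expnD 2 _ a).
  have : 0 < 2 ^ (m * t + a * K ^ t) by rewrite expn_gt0.
  have : 0 < 2 ^ a by rewrite expn_gt0.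
  by move: h31; set x := _ * _; set p := 2 ^ _; set q := 2 ^ a; nia.
have h4 : K.+1 ^ t <= E * t * K ^ t * D.
  have : 2 ^ (K.+1 ^ t) <= 2 ^ (E * t * K ^ t * D).
    rewrite expnM; apply: leq_trans h2 _; rewrite leq_exp2r //.
    exact: leq_trans h1 h3.
  by rewrite leq_exp2l.
have := quadratic_expn_leq K t.
set x := K ^ t in K1 h4 *; set y := K.+1 ^ t in h4 *.
move=> h5; have : x * (t * t.-1) <= 2 * K ^ 2 * (E * t * x * D) by nia.
have -> : 2 * K ^ 2 * (E * t * x * D) = x * (t * (2 * K ^ 2 * (D * E))) by nia.
by rewrite !leq_pmul2l // /t /=; lia.
Qed.
End Cube.

(** * Strongly abelian algebras *)

Section StronglyAbelian.
Variables (S : signature) (B : algebra S).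
Hypothesis sab : strongly_abelian B.

Definition mix n (P : pred 'I_n) (u v : 'I_n -> B) (i : 'I_n) : B := if P i then u i else v i.

Lemma strongly_abelian_upd k (t : pterm S void k) (p q : 'I_k -> B) l e :
  teval t p = teval t q ->
  teval t (fun i => if i == l then e else p i) = teval t (fun i => if i == l then e else q i).
Proof.
move=> tpq.
(* Renaming moves the variable [l] to the front, where the definition of strong abelianness
   applies. *)
pose t' := tsubst t (fun i => if i == l then PVar ord0 else PVar (lift ord0 i)) : pterm S void k.+1.
have t'E a c : teval t' (ext1 a c) = teval t (fun i => if i == l then a else c i).
  rewrite teval_subst; congr teval; apply: functional_extensionality => i.
  by case: ifP => _; rewrite /teval /= /ext1 ?unlift_none ?liftK.
rewrite -!t'E; apply: (@sab _ t' (p l) (q l)); rewrite !t'E.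
have eqE (u : 'I_k -> B) : (fun i => if i == l then u l else u i) = u.
  by apply: functional_extensionality => i; case: eqP => [->|].
by rewrite !eqE.
Qed.

Lemma strongly_abelian_mix k (t : pterm S void k) (p q e : 'I_k -> B) (P : pred 'I_k) :
  teval t p = teval t q -> teval t (mix P e p) = teval t (mix P e q).
Proof.
move=> tpq.
suff H s : teval t (mix (mem (s : seq 'I_k)) e p) = teval t (mix (mem s) e q).
  have := H (enum P); congr (teval t _ = teval t _); apply: functional_extensionality => i;
    by rewrite /mix /= mem_enum.
elim: s => [|l s /(strongly_abelian_upd l (e l)) IHs]; first exact: tpq.
move: IHs; congr (teval t _ = teval t _); apply: functional_extensionality => i;
  by rewrite /mix /= inE; case: eqP => [->|].
Qed.

Definition essential k (t : pterm S void k) (l : 'I_k) : Prop :=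
  exists (x : 'I_k -> B) (u v : B),
    teval t (fun i => if i == l then u else x i) <> teval t (fun i => if i == l then v else x i).

Definition essentials k (t : pterm S void k) : {set 'I_k} := [set l | pbool (essential t l)].

(* Changing any set of essential variables from one of the witnesses of
   essentiality to the other changes the value of the term. *)
Lemma card_essentials k (t : pterm S void k) : 0 < #|B| -> 2 ^ #|essentials t| <= #|B|.
Proof.
move=> /card_gt0P [b0 _].
have /fin_all_exists [w hw] (l : 'I_k) : exists xuv : ('I_k -> B) * B * B, l \in essentials t ->
    teval t (fun i => if i == l then xuv.1.2 else xuv.1.1 i) <>
    teval t (fun i => if i == l then xuv.2 else xuv.1.1 i).
  case: (boolP (l \in essentials t)) => [|_].
    by rewrite inE => /pboolP [x [u [v h]]]; exists (x, u, v).
  by exists (fun=> b0, b0, b0).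
rewrite -card_powerset.
pose val (s : {set 'I_k}) i := if i \in s then (w i).1.2 else (w i).2.
suff inj : {in powerset (essentials t) &, injective (fun s => teval t (val s))}.
  by rewrite -(card_in_imset inj) max_card.
move=> s1 s2; rewrite !inE => sub1 sub2 /= e12; apply/setP => l.
have H (s s' : {set 'I_k}) : s \subset essentials t -> teval t (val s) = teval t (val s') ->
    l \in s -> l \in s'.
  move=> sub e ls; apply/negPn/negP => ls'; apply: (hw l (subsetP sub _ ls)).
  (* Overwriting all coordinates but [l] by the context witnessing essentiality leaves the two
     witness values at [l]. *)
  have := strongly_abelian_mix (w l).1.1 (predC1 l) e.
  congr (teval t _ = teval t _); apply: functional_extensionality => i;
    rewrite /mix /=; case: eqP => [->|] //=; by rewrite /val ?ls ?(negPf ls').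
by apply/idP/idP; apply: H.
Qed.

Lemma teval_essentials k (t : pterm S void k) (p q : 'I_k -> B) :
  {in essentials t, p =1 q} -> teval t p = teval t q.
Proof.
move=> epq.
suff H s : teval t p = teval t (mix (mem (s : seq 'I_k)) q p).
  rewrite (H (enum 'I_k)); congr teval; apply: functional_extensionality => i.
  by rewrite /mix /= mem_enum.
elim: s => [|l s ->] //; set r := mix _ q p.
case: (boolP (l \in essentials t)) => hl.
  congr teval; apply: functional_extensionality => i; rewrite /r /mix /= inE.
  by case: eqP => [->|] //=; rewrite epq //; case: ifP.
have : teval t (fun i => if i == l then r l else r i) =
    teval t (fun i => if i == l then q l else r i).
  case: (eqVneq (teval t (fun i => if i == l then r l else r i))
    (teval t (fun i => if i == l then q l else r i))) => // h.
  by move: hl; rewrite inE => /pboolP []; exists r, (r l), (q l); apply/eqP.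
rewrite (_ : (fun i => if i == l then r l else r i) = r); last first.
  by apply: functional_extensionality => i; case: eqP => [->|].
move=> ->; congr teval; apply: functional_extensionality => i.
by rewrite /r /mix /= inE; case: eqP => [->|].
Qed.

(** A term has fewer than [r] essential variables, so its value is coded by a table of arity [r] and
    a choice of generator, or none, for each slot. The right-hand side counts the codes. *)
Lemma term_card_bound (I : finType) k (g : 'I_k -> I -> B) :
  0 < #|B| ->
  (forall y : I -> B, exists t : pterm S void k, forall i, y i = teval t (fun l => g l i)) ->
  #|B| ^ #|I| <= #|B| ^ (#|B| ^ #|B|) * k.+1 ^ #|B|.
Proof.
move=> B_gt0 hg; have /card_gt0P [b0 _] := B_gt0; set r := #|B|.
pose code := ({ffun {ffun 'I_r -> B} -> B} * {ffun 'I_r -> option 'I_k})%type.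
pose dec (c : code) : {ffun I -> B} :=
  [ffun i => c.1 [ffun j => if c.2 j is Some l then g l i else b0]].
suff surj y : exists c, dec c = y.
  have : #|{ffun I -> B}| <= #|{: code}|.
    have /fin_all_exists [enc henc] := surj.
    by apply: (@leq_card _ _ enc) => y1 y2 e; rewrite -(henc y1) e henc.
  by rewrite card_prod !card_ffun !card_ord card_option card_ord.
have [t ht] := hg y; pose E := enum (essentials t).
have hE : size E < r.
  by rewrite -cardE; apply: leq_trans (card_essentials t B_gt0); apply: ltn_expl.
exists ([ffun v : {ffun 'I_r -> B} =>
           teval t (fun l => if insub (index l E) is Some j then v j else b0)],
        [ffun j : 'I_r => ohead (drop j E)]).
apply/ffunP => i; rewrite [LHS]ffunE [LHS]ffunE.
rewrite ht; apply: teval_essentials => l hl.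
have lE : index l E < size E by rewrite index_mem mem_enum.
rewrite (insubT (fun x => x < r) (ltn_trans lE hE)) ffunE /= ffunE /=.
by rewrite (drop_nth l lE) /= nth_index // mem_enum.
Qed.
End StronglyAbelian.

(** The coordinates are cut into [n %/ m] blocks of length [m], and [h] is applied to each; leftover
    coordinates are filled with [a0]. *)
Lemma power_image_generated (S : signature) (A B : algebra S) m n k (h : power_alg A m -> B) :
  0 < #|A| -> 0 < m -> is_hom h -> (forall y, exists x, h x = y) -> generated_by_k A n k ->
  exists g : 'I_k -> 'I_(n %/ m) -> B,
    forall y, exists t : pterm S void k, forall i, y i = teval t (fun l => g l i).
Proof.
move=> /card_gt0P [a0 _] m_gt0 hh hsurj [g hg].
have lt_n (i : 'I_(n %/ m)) (l : 'I_m) : i * m + l < n.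
  apply: leq_trans (leq_divM n m); case: i l => [i hi] [l hl] /=; nia.
pose block (i : 'I_(n %/ m)) (z : power_alg A n) : power_alg A m :=
  [ffun l => z (Ordinal (lt_n i l))].
have block_hom i : is_hom (h \o block i).
  move=> f args /=; rewrite -hh; congr h; apply/ffunP => l; rewrite !ffunE.
  by congr (aop _); apply: functional_extensionality => j; rewrite ffunE.
exists (fun l i => h (block i (g l))) => y.
have /fin_all_exists [x hx] i := hsurj (y i).
pose Y : power_alg A n := [ffun j : 'I_n =>
  if insub (j %/ m) is Some i then x i (Ordinal (ltn_pmod j m_gt0)) else a0].
have [t ht] := hg Y; exists t => i; rewrite -(teval_hom _ _ (block_hom i)) -ht -hx /=.
congr h; apply/ffunP => l; rewrite ffunE ffunE /=.
have e : (i * m + l) %/ m = i by rewrite divnMDl // (divn_small (ltn_ord l)) addn0.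
rewrite e insubT //= => hi.
congr (x _ _); apply: val_inj => //=.
by rewrite modnMDl modn_small.
Qed.

Lemma strongly_abelian_image_exp (S : signature) (A : algebra S) :
  0 < #|A| -> cond_v A -> cond_vi A.
Proof.
move=> A_gt0 hv [m [B [h [hh hsurj B_gt1 sab]]]]; apply/hv/exp_Omega_natP.
have m_gt0 : 0 < m.
  rewrite lt0n; apply/eqP => m0; move: B_gt1; rewrite ltnNge => /negP; apply.
  have /fin_all_exists [s hs] := hsurj.
  have /leq_trans -> // : #|B| <= #|power_alg A m| by apply: (@leq_card _ _ s); apply: can_inj hs.
  by rewrite card_ffun card_ord m0.
set b := #|B| in B_gt1; pose C := b ^ b.
(* Beyond this threshold [n <= 2m (q - C - b)]; the factor [b] of the exponent comes from the bound
   [k.+1 ^ b]. *)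
exists (2 * m * b), (2 * m * (C + b + 1)); split; first by rewrite !muln_gt0 m_gt0 (ltnW B_gt1).
move=> n hn; set k := dA A n; set q := n %/ m.
have [g hg] := power_image_generated A_gt0 m_gt0 hh hsurj (dA_gen A n).
have := term_card_bound sab (ltnW B_gt1) hg; rewrite card_ord -/b -/C -/k -/q => hb; clearbody C.
have hq : n < q.+1 * m by exact: ltn_ceil.
have hqC : C + b < q by nia.
have h1 : 2 ^ (q - C) <= k.+1 ^ b.
  apply: (@leq_trans (b ^ (q - C))); first exact: leq_expl.
  rewrite -(@leq_pmul2l (b ^ C)) ?expn_gt0 ?(ltnW B_gt1) // -expnD subnKC //; lia.
have k_gt0 : 0 < k.
  rewrite lt0n; apply/eqP => k0; move: h1; rewrite k0 exp1n leqNgt => /negP; apply.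
  by rewrite -[1](expn0 2) ltn_exp2l //; lia.
(* Replacing [k + 1] by [2k] costs the factor [2^b]. *)
have h2 : 2 ^ (q - C - b) <= k ^ b.
  rewrite -(@leq_pmul2l (2 ^ b)) ?expn_gt0 // -expnD subnKC; last by lia.
  by apply: leq_trans h1 _; rewrite -expnMn; apply: leq_expl; lia.
rewrite (mulnC _ b) expnM; apply: leq_trans (leq_expl _ h2).
rewrite -expnM leq_exp2l //; nia.
Qed.

(** * Separating examples *)

(** An element that is an argument of every operation producing it must belong to every generating
    set. *)
Lemma irreducible_dA (S : signature) (A : algebra S) n (J : finType) (e : J -> power_alg A n) :
  injective e -> (forall j f args, e j = @aop S (power_alg A n) f args -> exists l, args l = e j) ->
  #|J| <= dA A n.
Proof.
move=> inj irr; have [g hg] := dA_gen A n.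
have H j : exists l, g l = e j.
  have [t] := hg (e j); rewrite /teval; elim: t => [l ->|[]|f ts IH] /=; first by exists l.
  by move=> h; have [l hl] := irr _ _ _ h; apply: (IH l).
have /fin_all_exists [idx hidx] := H.
suff /leq_card : injective idx by rewrite card_ord.
by move=> i j eij; apply: inj; rewrite -!hidx eij.
Qed.

Definition pair2 (T : Type) (u v : T) (i : 'I_2) : T := if i == ord0 then u else v.

Lemma ord2P (i : 'I_2) : i = ord0 \/ i = ord_max.
Proof. by case: i => [[|[|]]] // hi; [left|right]; apply: val_inj. Qed.

Definition sig_binary (I : Type) : signature := @Sig I (fun _ => 2).

Definition flat_meet (T : eqType) (x y : option T) : option T := if x == y then x else None.

(** * The flat semilattice with two atoms *)

Definition flat_semilattice : algebra (sig_binary unit) :=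
  @Algebra (sig_binary unit) (option bool) (fun _ args => flat_meet (args ord0) (args ord_max)).

(** In a semilattice [(uv)u = (uv)v], so strong abelianness gives [wu = wv] for all [w]; taking
    [w = u] and [w = v] yields [u = uv = v]. *)
Lemma flat_semilattice_cond_vi : cond_vi flat_semilattice.
Proof.
move=> [n [B [h [hh hsurj /card_gt1P [u [v [_ _ /eqP uv]]] sab]]]]; apply: uv.
pose op (C : algebra (sig_binary unit)) (x y : C) := @aop _ C tt (pair2 x y).
have hop x y : h (op _ x y) = op _ (h x) (h y).
  by rewrite /op hh; congr (aop _);
    apply: functional_extensionality => i; rewrite /pair2; case: ifP.
have opE (x y : power_alg flat_semilattice n) i : op _ x y i = flat_meet (x i) (y i).
  by rewrite /op /= ffunE.
pose t : pterm (sig_binary unit) void 2 := PApp (S := sig_binary unit) tt (fun i : 'I_2 => PVar i).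
have tE (a c : B) : teval t (ext1 a (fun _ : 'I_1 => c)) = op _ a c.
  rewrite /teval /=; congr (aop _); apply: functional_extensionality => i.
  by case: (ord2P i) => ->; rewrite /ext1 ?unlift_none //= /pair2; case: unliftP.
have [x hx] := hsurj u; have [y hy] := hsurj v.
have e w : op B w u = op B w v.
  rewrite -!tE; apply: (sab _ _ (op B u v) (op B u v)); rewrite !tE -hx -hy -!hop.
  by congr h; apply/ffunP => i; rewrite !opE /flat_meet; case: (x i) => [[]|]; case: (y i) => [[]|].
have idem (z : power_alg flat_semilattice n) : op _ z z = z.
  by apply/ffunP => i; rewrite opE /flat_meet eqxx.
have eu := e u; have ev := e v; rewrite -hx -hy -!hop !idem in eu ev *.
rewrite eu -ev; congr h; apply/ffunP => i.
by rewrite !opE /flat_meet eq_sym; case: eqP.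
Qed.

(** The [2^n] tuples avoiding [None] are irreducible. *)
Lemma flat_semilattice_exp : exp_Omega_n (dA flat_semilattice).
Proof.
apply/exp_Omega_natP; exists 1, 0; split=> // n _; rewrite expn1.
pose e (j : {ffun 'I_n -> bool}) : power_alg flat_semilattice n := [ffun i => Some (j i)].
have <- : #|{ffun 'I_n -> bool}| = 2 ^ n by rewrite card_ffun card_bool card_ord.
apply: (@irreducible_dA _ _ _ _ e) => [j1 j2 /ffunP ej|j f args /ffunP ej].
  by apply/ffunP => i; have := ej i; rewrite !ffunE => -[].
exists ord0; apply/ffunP => i; have := ej i.
by rewrite !ffunE /= /flat_meet; case: eqP => // _ ->.
Qed.

(** * An algebra with a cube polynomial and quadratic growth *)

(* [None] absorbs every input other than (0,0,0) and the permutations of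
   (1,1,0): this makes the indicator functions of pairs irreducible. *)
Definition pair_op (x y z : option bool) : option bool :=
  if (x, y, z) is (Some a, Some b, Some c) then
    if a (+) b (+) c then None else Some [|| a, b | c]
  else None.

Lemma ord3P (i : 'I_3) : [\/ i = ord0, i = lift ord0 ord0 | i = ord_max].
Proof.
by case: i => [[|[|[|]]]] // hi; [constructor 1|constructor 2|constructor 3]; apply: val_inj.
Qed.

Lemma pair_op_true (f : 'I_3 -> option bool) :
  pair_op (f ord0) (f (lift ord0 ord0)) (f ord_max) = Some true ->
  exists l0, forall l, l != l0 -> f l = Some true.
Proof.
case e0 : (f ord0) => [[]|] //; case e1 : (f (lift ord0 ord0)) => [[]|] //;
  case e2 : (f ord_max) => [[]|] // _.
- by exists ord_max => l; case: (ord3P l) => ->.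
- by exists (lift ord0 ord0) => l; case: (ord3P l) => ->.
- by exists ord0 => l; case: (ord3P l) => ->.
Qed.

Lemma pair_op_false (f : 'I_3 -> option bool) l :
  pair_op (f ord0) (f (lift ord0 ord0)) (f ord_max) = Some false -> f l = Some false.
Proof.
case e0 : (f ord0) => [[]|] //; case e1 : (f (lift ord0 ord0)) => [[]|] //;
  case e2 : (f ord_max) => [[]|] // _.
by case: (ord3P l) => ->.
Qed.

Definition sig_ternary : signature := @Sig unit (fun _ => 3).

Definition pair_algebra : algebra sig_ternary :=
  @Algebra sig_ternary (option bool)
    (fun _ args => pair_op (args ord0) (args (lift ord0 ord0)) (args ord_max)).

Lemma pair_algebra_cube : cond_ii pair_algebra.
Proof.
exists 3, 3, (PApp (S := sig_ternary) tt (fun i : 'I_3 => PVar i)).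
exists (fun i j => if i == j then CConst (Some false : pair_algebra) else CVar 0).
split=> //; split; first by move=> j; exists j; rewrite eqxx.
move=> s; case=> [[|[|[|i]]] hi] //; rewrite /poleval /=; by case: (s 0) => [[]|].
Qed.

(** If an operation yields the indicator of a pair, each point of the pair excludes at most one of
    the three arguments; the remaining one is true on the pair and false elsewhere. *)
Lemma pair_algebra_dA n : n * n.-1 <= 2 * dA pair_algebra n.
Proof.
pose e (s : {s : {set 'I_n} | #|s| == 2}) : power_alg pair_algebra n :=
  [ffun i => Some (i \in val s)].
have -> : n * n.-1 = 2 * #|{: {s : {set 'I_n} | #|s| == 2}}|.
  rewrite card_sig -(eq_card (fun s => in_set _ s)) card_draws card_ord.
  by have := bin_ffact n 2; rewrite ffactnS ffactn1 mulnC => <-.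
rewrite leq_pmul2l //; apply: (@irreducible_dA _ _ _ _ e).
  move=> s1 s2 /ffunP es; apply/val_inj/setP => i.
  by have := es i; rewrite !ffunE => -[].
move=> [s hs] f args /ffunP es; have /cards2P [i [j [ij s_ij]]] := hs.
have es' c : pair_op (args ord0 c) (args (lift ord0 ord0) c) (args ord_max c) = Some (c \in s).
  by have := es c; rewrite !ffunE.
have [li hi] : exists l0, forall l, l != l0 -> args l i = Some true.
  by apply: (pair_op_true (f := fun l => args l i)); rewrite es' s_ij !inE eqxx.
have [lj hj] : exists l0, forall l, l != l0 -> args l j = Some true.
  by apply: (pair_op_true (f := fun l => args l j)); rewrite es' s_ij !inE eqxx orbT.
have [l] : exists l, l \notin [set li; lj].
  apply/existsP; rewrite -negb_forall; apply/negP => /forallP hall.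
  have : #|[set li; lj]| = 3.
    by rewrite -[RHS](card_ord 3) -cardsT; congr #|pred_of_set _|;
      apply/setP => l; rewrite hall inE.
  by rewrite cards2; case: (li == lj).
rewrite !inE negb_or => /andP [hli hlj]; exists l; apply/ffunP => c; rewrite ffunE /=.
have := es' c; case: (boolP (c \in s)) => hc; last first.
  by move=> h; apply: (pair_op_false (f := fun l => args l c)).
by move: hc; rewrite s_ij !inE => /orP [] /eqP -> _; [apply: hi | apply: hj].
Qed.

(** * The plane over the two-element field *)

Local Open Scope ring_scope.

Lemma F2P (a b c : 'F_2) : a != b -> c = a \/ c = b.
Proof.
case: a b c => [[|[|a]] ha] // [[|[|b]] hb] // [[|[|c]] hc] // _;
  by [left; apply: val_inj | right; apply: val_inj].
Qed.

(* Only the first coordinates of the arguments are ever read, so a polynomial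
   that is not a variable cannot recover the second coordinate of [x]. *)
Definition plane_algebra : algebra (sig_binary bool) :=
  @Algebra (sig_binary bool) ('F_2 * 'F_2)%type
    (fun add args => if add then ((args ord0).1 + (args ord_max).1, 0)
                     else ((args ord0).1, (args ord_max).1)).

Lemma plane_poly_affine n (t : pterm (sig_binary bool) plane_algebra n) :
  exists (c : 'F_2) (k : 'I_n -> 'F_2),
    forall x, (poleval t x).1 = c + \sum_i k i * (x i).1.
Proof.
elim: t => [j|a|f ts IH].
- exists 0, (fun i => (i == j)%:R) => x; rewrite add0r (bigD1 j) //= eqxx mul1r big1 ?addr0 //.
  by move=> i /negPf ->; rewrite mul0r.
- by exists a.1, (fun=> 0) => x; rewrite big1 ?addr0 // => i _; rewrite mul0r.
have [c1 [k1 h1]] := IH ord0; have [c2 [k2 h2]] := IH ord_max.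
case: f ts IH h1 h2 => ts IH h1 h2; last by exists c1, k1.
exists (c1 + c2), (fun i => k1 i + k2 i) => x.
rewrite /poleval /= in h1 h2 *; rewrite h1 h2 addrACA -big_split /=; congr (_ + _).
by apply: eq_bigr => i _; rewrite mulrDl.
Qed.

(** A variable fails in a row where its column is not [x]; any other polynomial cannot tell [(0, 0)]
    from [(0, 1)]. *)
Lemma plane_algebra_no_cube : ~ cond_ii plane_algebra.
Proof.
move=> [m [k [F [M [k_gt0 [hcol FM]]]]]].
have [[j hj]|hF] : (exists j, F = PVar j) \/
    forall x y : 'I_m -> plane_algebra, (forall i, (x i).1 = (y i).1) -> poleval F x = poleval F y.
- case: F {FM} => [j|a|f ts]; [by left; exists j | by right | right].
  move=> x y xy; rewrite /poleval /=.
  have e l : (poleval (ts l) x).1 = (poleval (ts l) y).1.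
    have [c [ks h]] := plane_poly_affine (ts l); rewrite !h; congr (_ + _).
    by apply: eq_bigr => i _; rewrite xy.
  by rewrite /poleval in e; rewrite !e.
- have [i hi] := hcol j; move: (FM) hi; rewrite hj /poleval /= => {}FM.
  have h0 := FM (fun v => if v is 0%N then (0, 0) else (1, 1)) i.
  have h1 := FM (fun v => if v is 0%N then (1, 1) else (0, 0)) i.
  by move: h0 h1; case: (M i j) => [[|v]|a] //= ->.
- have h0 := FM (fun=> (0, 0)) (Ordinal k_gt0).
  have h1 := FM (fun=> (0, 1)) (Ordinal k_gt0).
  suff : (0, 0) = (0, 1) :> 'F_2 * 'F_2 by [].
  rewrite -[LHS]h0 -[RHS]h1; apply: hF => j.
  by case: (M _ j).
Qed.

Definition fst_eq : rel plane_algebra := fun x y => x.1 == y.1.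
Definition axis : {set plane_algebra} := [set x | x.2 == 0].

Definition padd n (t u : pterm (sig_binary bool) plane_algebra n) :
    pterm (sig_binary bool) plane_algebra n :=
  PApp (S := sig_binary bool) true (pair2 t u).

Lemma poleval_padd n (t u : pterm (sig_binary bool) plane_algebra n) x :
  poleval (padd t u) x = ((poleval t x).1 + (poleval u x).1, 0).
Proof. by []. Qed.

Lemma fst_eq_prime : @prime_quot _ plane_algebra fst_eq (fun _ _ => true).
Proof.
split=> //.
- split; first by move=> x y z; split=> [|/eqP xy]; rewrite /fst_eq ?xy // eqxx.
  move=> [] a b h; rewrite /fst_eq /= ?(eqP (h ord0)) ?(eqP (h ord_max)) //.
- by exists (0, 0), (1, 0).
move=> g hg sub _.
case: (boolP [forall a, forall b, g a b ==> fst_eq a b]) => [/forallP h|].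
  left=> a b; apply/idP/idP; last exact: sub.
  by move/forallP: (h a) => /(_ b)/implyP.
rewrite negb_forall => /existsP [a]; rewrite negb_forall => /existsP [b].
rewrite negb_imply => /andP [gab nab]; right=> x y.
have gr := congr_refl hg; have gs := congr_sym hg; have gt := congr_trans hg.
have toa z : g z a.
  case: (F2P z.1 nab) => e; first by apply: sub; rewrite /fst_eq e.
  by apply: (gt b); [apply: sub; rewrite /fst_eq e | rewrite gs].
by apply: (gt a); rewrite // gs.
Qed.

(** The axis is the range of [x + 0], and over two elements a range inside it with two distinct
    first coordinates fills it. *)
Lemma axis_minimal : minimal_set (A := plane_algebra) fst_eq (fun _ _ => true) axis.
Proof.
split.
  exists (padd (PVar ord0) (PConst (0, 0))); split; last first.
    by exists (0, 0), (1, 0).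
  apply/setP => -[a b]; rewrite inE /=; apply/eqP/imsetP => [->|[x _ [_ ->]] //].
  by exists (a, 0); rewrite // poleval_padd /= addr0.
move=> V [f [-> [a [b [_ nab]]]]] /subsetP sV; apply/eqP; rewrite eqEsubset.
apply/andP; split; first exact/subsetP.
apply/subsetP => x; rewrite inE => /eqP x2.
have im z : poleval f (fun=> z) \in [set poleval f (fun=> z) | z in plane_algebra].
  by apply: imset_f.
have im2 z : (poleval f (fun=> z)).2 = 0 by have := sV _ (im z); rewrite inE => /eqP.
have eqx z : x.1 = (poleval f (fun=> z)).1 -> x = poleval f (fun=> z).
  by move=> e; rewrite [x]surjective_pairing [RHS]surjective_pairing im2 x2 e.
by case: (F2P x.1 nab) => /eqx ->; apply: im.
Qed.

Lemma axis_type2 : minalg_type2 (A := plane_algebra) fst_eq axis.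
Proof.
exists 'F_2, fst; split=> //.
- by move=> y; exists (y, 0); rewrite ?inE.
- move=> n t _; have [c [k h]] := plane_poly_affine t.
  by exists c, k => x _; apply: h.
move=> n c k.
(* Coefficients are 0 or 1, so an affine map is a sum of variables and a constant. *)
pose mon i : pterm (sig_binary bool) plane_algebra n :=
  if k i == 0 then PConst (0, 0) else PVar i.
pose t := foldr (fun i => padd (mon i)) (PConst (c, 0)) (index_enum 'I_n).
exists t; split=> [x _|x _].
  by rewrite inE /t; case: (index_enum _) => //=.
rewrite addrC /t; elim: (index_enum _) => [|i s IHs]; first by rewrite big_nil add0r.
rewrite big_cons -addrA -IHs [foldr _ _ _ in LHS]/= poleval_padd [LHS]/=; congr (_ + _).
rewrite /mon; case: eqP => [->|/eqP]; first by rewrite mul0r.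
rewrite eq_sym => /(F2P 1) [//|<-].
by rewrite mul1r.
Qed.

Lemma plane_algebra_spread : cond_iii plane_algebra.
Proof.
exists 2, (PApp (S := sig_binary bool) false (fun i : 'I_2 => PVar i)), (fun=> axis); split.
  move=> _; exists fst_eq, (fun _ _ => true); split; last exact: axis_minimal.
  split; first exact: fst_eq_prime.
  exists axis, axis; split; [exact: axis_minimal | | exact: axis_type2].
  split; first by exists (0, 0); apply/setP => x; rewrite !inE andbT.
  by exists (0, 0), (1, 0); rewrite !inE.
move=> [a b]; exists (pair2 (a, 0) (b, 0)); split=> // i.
by rewrite /pair2; case: ifP; rewrite inE.
Qed.

Local Close Scope ring_scope.

(** * The two-element Boolean ring *)

Definition boolean_ring : algebra (sig_binary bool) :=
  @Algebra (sig_binary bool) bool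
    (fun add args => if add then args ord0 (+) args ord_max else args ord0 && args ord_max).

Lemma boolean_ring_maltsev : cond_i boolean_ring.
Proof.
pose var i : pterm (sig_binary bool) boolean_ring 3 := PVar i.
exists (PApp (S := sig_binary bool) true (pair2 (var ord0)
  (PApp (S := sig_binary bool) true (pair2 (var (lift ord0 ord0)) (var ord_max))))) => x y.
by rewrite /poleval /= /tup3 /=; case: x; case: y.
Qed.

(** A trace must contain both elements, and conjunction is not affine on them. *)
Lemma boolean_ring_no_type2 U : ~ type2_minset (A := boolean_ring) U.
Proof.
move=> [al [be [[[hal _ _ _ _] [U' [N [_ [_ [x [y [xN yN nxy]]]] hM]]]] _]]].
have nxy' : x <> y by move=> e; move: nxy; rewrite e congr_refl.
have NT z : z \in N by case: x y z xN yN nxy' {nxy} => [] [] [] //.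
case: hM => F [phi [_ phi_al haff _]].
have nphi : phi x <> phi y by move/eqP; rewrite phi_al // (negPf nxy).
have [c [k h]] := haff 2
  (PApp (S := sig_binary bool) false (fun i : 'I_2 => PVar i)) (fun _ _ => NT _).
have f a b : phi (a && b) = (c + (k ord0 * phi a + k (lift ord0 ord0) * phi b))%R.
  have := h (pair2 a b) (fun _ => NT _).
  by rewrite big_ord_recl big_ord1.
apply: nphi; suff e : phi true = phi false by case: (x) (y) => [] [].
have e1 : (k ord0 * phi true = k ord0 * phi false)%R.
  by have /addrI /addIr := etrans (esym (f true false)) (f false false).
by have := f true true; rewrite e1 -f.
Qed.

Lemma boolean_ring_no_spread : ~ cond_iii boolean_ring.
Proof.
(* With no minimal sets at all, [p] takes a single value and misses an element. *)
move=> [[|k] [p [Us [hU hp]]]]; last exact: boolean_ring_no_type2 (hU ord0).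
have [x [_ hx]] := hp true; have [y [_ hy]] := hp false.
suff exy : x = y by move: hy; rewrite -exy hx.
by apply: functional_extensionality => -[].
Qed.

Theorem theorem2p12 :
  (forall (S : signature) (A : algebra S), (0 < #|A|)%N ->
     (cond_i A -> cond_iv A) /\
     (cond_i A -> cond_ii A) /\
     (cond_ii A -> cond_v A) /\
     (cond_iii A -> cond_iv A) /\
     (cond_iv A -> cond_v A) /\
     (cond_v A -> cond_vi A)) /\
  (witnessed cond_vi cond_v /\
   witnessed cond_v cond_iv /\
   witnessed cond_iv cond_iii /\
   witnessed cond_iii cond_ii /\
   witnessed cond_ii cond_iv /\
   witnessed cond_iv cond_ii /\
   witnessed cond_i cond_iii).
Proof.
have spread_witness : witnessed cond_iii cond_ii.
  exists (sig_binary bool), plane_algebra; split; last first.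
    by split; [exact: plane_algebra_spread | exact: plane_algebra_no_cube].
  by apply/card_gt0P; exists (0, 0)%R.
have cube_witness : witnessed cond_ii cond_iv.
  exists sig_ternary, pair_algebra; split; last first.
    by split; [exact: pair_algebra_cube | exact: bigO_not_quadratic pair_algebra_dA].
  by rewrite /= card_option card_bool.
have maltsev_witness : witnessed cond_i cond_iii.
  exists (sig_binary bool), boolean_ring; split; first by rewrite /= card_bool.
  by split; [exact: boolean_ring_maltsev | exact: boolean_ring_no_spread].
split.
  move=> S A A_gt0; split; first exact: maltsev_dA.
  split; first exact: maltsev_cube.
  split; first exact: cube_not_exp.
  split; first exact: spread_dA.
  split; first exact: bigO_not_exp.
  exact: strongly_abelian_image_exp.
split.
  exists (sig_binary unit), flat_semilattice; split; first by rewrite /= card_option card_bool.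
  split; first exact: flat_semilattice_cond_vi.
  by move/(_ flat_semilattice_exp).
split.
  have [S [A [A_gt0 [h1 h2]]]] := cube_witness; exists S, A; do 2!split=> //.
  exact: cube_not_exp.
split.
  have [S [A [A_gt0 [h1 h2]]]] := maltsev_witness; exists S, A; do 2!split=> //.
  exact: maltsev_dA.
split=> //; split=> //; split=> //.
have [S [A [A_gt0 [h1 h2]]]] := spread_witness; exists S, A; do 2!split=> //.
exact: spread_dA.
Qed.
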